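(* Let $A,B\subset\mathbb{Z}_c$ be two generated scales, each with at least two elements, which are complementary, i.e. $B=\mathbb{Z}_c\setminus A$. Then some translate of one of them is a subset of the other: there is $\tau\in\mathbb{Z}_c$ such that $A+\tau\subset B$ or $B+\tau\subset A$. In particular, $A$ and $B$ have a common generator.
   Context: $\mathbb{Z}_c=\mathbb{Z}/c\mathbb{Z}$ is the cyclic group with $c$ elements. A scale is a subset of $\mathbb{Z}_c$. A scale $A$ with $d$ elements is generated by $f\in\mathbb{Z}_c$ (and $f$ is a generator of $A$) if $A=\{a,a+f,a+2f,\dots,a+(d-1)f\}$ for some $a\in A$. A generated scale is one that has at least one generator. *)

(* Defs.v *)
From mathcomp Require Import all_boot all_order all_algebra.

Set Implicit Arguments.
Unset Strict Implicit.
Unset Printing Implicit Defensive.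

Import GRing.Theory.
Local Open Scope ring_scope.

(* The number d of elements of the scale is #|A|; since the right-hand side  *)
(* must have #|A| elements, the listed values are pairwise distinct.         *)
Definition generated_by (c : nat) (A : {set 'Z_c}) (f : 'Z_c) : Prop :=
  exists2 a : 'Z_c, a \in A & A = [set a + f *+ i | i : 'I_#|A|].

Definition generated_scale (c : nat) (A : {set 'Z_c}) : Prop :=
  exists f : 'Z_c, generated_by A f.

Definition translate (c : nat) (A : {set 'Z_c}) (tau : 'Z_c) : {set 'Z_c} :=
  [set x + tau | x in A].

(* Main.v *)
Require Import Defs.
From mathcomp Require Import all_boot all_order all_algebra.
From mathcomp Require Import all_fingroup.

Set Implicit Arguments.
Unset Strict Implicit.
Unset Printing Implicit Defensive.

Import GRing.Theory FinRing.Theory.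
Local Open Scope ring_scope.

(** Let A be generated by f and B by g, and write #[f] and #[g] for the orders
    of f and g in Z_c.  An arithmetic progression with step f lies in one coset
    of the subgroup <[f]>, so #|A| <= #[f] and #|B| <= #[g].

    If f generates Z_c as a group, then adding f runs once through all of Z_c:
    whatever is left after A is again a run of consecutive steps, so f
    generates B ([generated_setC_cycleT]).  The same holds with g and the roles
    of A and B exchanged.  If neither f nor g generates Z_c, then <[f]> and
    <[g]> have index at least 2, so #[f] and #[g] are at most half of the
    cardinal of Z_c; as #|A| and #|B| add up to that cardinal, all these bounds
    are equalities.  Then A is a coset of <[f]>, a subgroup of index 2, and its
    complement B is the other coset, which f generates too
    ([generated_setC_half]).

    Thus a common generator always exists.  Two progressions with the same step
    differ only by their starting points and their lengths, and hence the
    shorter one can be translated into the longer one ([translate_generated]). *)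

Section Progressions.

Variable c : nat.
Implicit Types (A B : {set 'Z_c}) (a b f x : 'Z_c) (n : nat).

Definition progression a f n : {set 'Z_c} := [set a + f *+ i | i : 'I_n].

Lemma mem_progression a f n i : (i < n)%N -> a + f *+ i \in progression a f n.
Proof. by move=> lt_in; apply/imsetP; exists (Ordinal lt_in). Qed.

Lemma card_progression_le a f n : (#|progression a f n| <= n)%N.
Proof. by rewrite -[leqRHS](card_ord n) leq_imset_card. Qed.

Lemma progression_sub_cycle a f n x :
  x \in progression a f n -> x - a \in <[f]>%g.
Proof.
by case/imsetP=> i _ ->; rewrite addrC addKr -zmodXgE mem_cycle.
Qed.

Lemma progression_cycle a f x :
  x - a \in <[f]>%g -> x \in progression a f #[f]%g.
Proof.
case/cyclePmin=> i lt_i; rewrite zmodXgE => /(canRL (subrK a)) ->.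
by rewrite addrC mem_progression.
Qed.

(** A progression of #|A| terms has at most #|A| elements, so counting gives the
    reverse inclusion, and with it the distinctness of the terms. *)
Lemma generated_sub_progression A a f :
  (0 < #|A|)%N -> A \subset progression a f #|A| -> generated_by A f.
Proof.
move=> A_gt0 sA.
have eA : A = progression a f #|A|.
  by apply/eqP; rewrite eqEcard sA card_progression_le.
exists a => //.
by rewrite eA -[X in X \in _]addr0 -(mulr0n f) mem_progression.
Qed.

Lemma card_generated_le A f : generated_by A f -> (#|A| <= #[f]%g)%N.
Proof.
case=> a _ eA; rewrite -(card_imset _ (@addIr _ (- a))).
apply: subset_leq_card; apply/subsetP=> _ /imsetP[x xA ->].
by rewrite eA in xA; exact: progression_sub_cycle xA.
Qed.

Lemma generated_setC_cycleT A f : <[f]>%g = [set: 'Z_c] ->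
  generated_by A f -> (0 < #|~: A|)%N -> generated_by (~: A) f.
Proof.
move=> fT [a _ eA] C_gt0.
(* The complement starts where A stops, at the term of index #|A|. *)
apply: (@generated_sub_progression _ (a + f *+ #|A|)) => //.
apply/subsetP=> x; rewrite inE => xNA.
have : x - a \in <[f]>%g by rewrite fT inE.
case/progression_cycle/imsetP=> -[i /= lt_i] _ ex.
have le_Ai : (#|A| <= i)%N.
  by rewrite leqNgt; apply: contra xNA => lt_iA; rewrite ex eA mem_progression.
rewrite ex -(subnKC le_Ai) mulrnDr addrA mem_progression //.
by rewrite ltn_subLR // cardsC -cardsT -fT.
Qed.

Lemma double_order_le f :
  <[f]>%g != [set: 'Z_c] -> (#[f]%g + #[f]%g <= #|'Z_c|)%N.
Proof.
move=> fNT; rewrite -cardsT -(Lagrange (subsetT <[f]>%g)) addnn -muln2.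
by rewrite leq_mul // indexg_gt1 subTset.
Qed.

(** A exhausts its coset of <[f]>, so the coset of any point outside A is
    disjoint from A; by its cardinal it is the whole complement. *)
Lemma generated_setC_half A f : generated_by A f ->
  #|A| = #[f]%g -> #|~: A| = #[f]%g -> generated_by (~: A) f.
Proof.
move=> [a aA eA] cA cC.
have C_gt0 : (0 < #|~: A|)%N by rewrite cC order_gt0.
have [b bC] := card_gt0P C_gt0.
apply: (@generated_sub_progression _ b) => //.
have AP x : (x \in A) = (x - a \in <[f]>%g).
  apply/idP/idP; first by rewrite {1}eA => /progression_sub_cycle.
  by move/progression_cycle; rewrite -cA /progression -eA.
have eC : (<[f]> :* b)%g = ~: A.
  apply/eqP; rewrite eqEcard card_rcoset cC leqnn andbT.
  apply/subsetP=> _ /rcosetP[h hf ->]; move: bC; rewrite !inE !AP zmodMgE.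
  by rewrite -addrA -(groupMl (b - a) hf) zmodMgE.
apply/subsetP=> x; rewrite -{1}eC cC => /rcosetP[h hf ->].
by apply: progression_cycle; rewrite zmodMgE addrK.
Qed.

Lemma common_generator A f g : generated_by A f -> generated_by (~: A) g ->
  exists h, generated_by A h /\ generated_by (~: A) h.
Proof.
move=> Af Cg.
have A_gt0 : (0 < #|A|)%N by case: Af => a aA _; apply/card_gt0P; exists a.
have C_gt0 : (0 < #|~: A|)%N by case: Cg => b bC _; apply/card_gt0P; exists b.
have [fT | fNT] := eqVneq (<[f]>%g : {set 'Z_c}) [set: 'Z_c].
  by exists f; split=> //; exact: generated_setC_cycleT.
have [gT | gNT] := eqVneq (<[g]>%g : {set 'Z_c}) [set: 'Z_c].
  exists g; split=> //; rewrite -[A]setCK.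
  by apply: generated_setC_cycleT; rewrite ?setCK.
exists f; split=> //.
have leA := card_generated_le Af; have leC := card_generated_le Cg.
(* 2 #[f] and 2 #[g] are at most #|A| + #|~: A|, while #|A| <= #[f] and
   #|~: A| <= #[g]: this squeezes #|A|, #|~: A| and #[f] to the same value. *)
have := double_order_le fNT; have := double_order_le gNT.
rewrite -(cardsC A) => le_g le_f.
have le_CA : (#|~: A| <= #|A|)%N.
  by rewrite -(leq_add2r #|~: A|); apply: leq_trans le_g; exact: leq_add.
have le_fC : (#[f]%g <= #|~: A|)%N.
  by rewrite -(leq_add2l #|A|); apply: leq_trans le_f; rewrite leq_add2r.
apply: generated_setC_half => //; apply/eqP; rewrite eqn_leq.
  by rewrite leA (leq_trans le_fC).
by rewrite le_fC (leq_trans le_CA).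
Qed.

Lemma translate_generated A B f : generated_by A f -> generated_by B f ->
  (#|A| <= #|B|)%N -> exists tau, translate A tau \subset B.
Proof.
move=> [a _ eA] [b _ eB] leAB; exists (b - a).
apply/subsetP=> _ /imsetP[x xA ->].
move: xA; rewrite eA => /imsetP[[i /= lt_i] _ ->].
by rewrite addrC addrA subrK eB mem_progression // (leq_trans lt_i).
Qed.

End Progressions.

Theorem theorem5 (c : nat) (hc : (1 < c)%N) (A B : {set 'Z_c})
    (genA : generated_scale A) (genB : generated_scale B)
    (cardA : (2 <= #|A|)%N) (cardB : (2 <= #|B|)%N)
    (complAB : B = ~: A) :
  (exists tau : 'Z_c, translate A tau \subset B \/ translate B tau \subset A) /\
  (exists f : 'Z_c, generated_by A f /\ generated_by B f).
Proof.
case: genA => f0 Af0; case: genB => g0; rewrite complAB => Cg0.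
have [f [Af Cf]] := common_generator Af0 Cg0.
split; last by exists f.
have [le | /ltnW le] := leqP #|A| #|~: A|.
  by have [tau] := translate_generated Af Cf le; exists tau; left.
by have [tau] := translate_generated Cf Af le; exists tau; right.
Qed.
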